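(* Let $n$ and $k$ be positive integers with $2k\le n$. Then $b(n,k)$ is the smallest positive integer $\ell$ such that \[ \sum_{\substack{\pi\text{ partition of }n\\ \pi=(1^{c_1},2^{c_2},\ldots,n^{c_n})}}(-1)^{n-\sum_{i=1}^nc_i}\frac{n!}{\prod_{i=1}^n i^{c_i}c_i!}\left(\sum_{\substack{\eta\text{ partition of }k\\ \eta=(1^{b_1},2^{b_2},\ldots,k^{b_k})}}\prod_{j=1}^k\binom{c_j}{b_j}\right)^{\ell}\neq 0 . \]
   Context: For a permutation group $G$ on a set $\Omega$, a subset $\Lambda\subseteq\Omega$ is a base if the pointwise stabilizer of $\Lambda$ in $G$ is trivial, and the base size of $G$ is the smallest cardinality of a base. $b(n,k)$ denotes the base size of the symmetric group $\mathrm{Sym}(n)$ in its natural action on the set of all $k$-subsets of $\{1,\ldots,n\}$. A partition of $n$ is written in exponential notation $\pi=(1^{c_1},2^{c_2},\ldots,n^{c_n})$, where $c_i\ge 0$ is the number of parts of $\pi$ equal to $i$ (so $\sum_i ic_i=n$); similarly a partition $\eta$ of $k$ is written $(1^{b_1},\ldots,k^{b_k})$. The outer sum runs over all partitions of $n$ and the inner sum over all partitions of $k$; $\binom{c}{b}=0$ when $b>c$. *)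

(* Defs.v *)
From mathcomp Require Import all_boot all_order all_fingroup all_algebra.

Set Implicit Arguments.
Unset Strict Implicit.
Unset Printing Implicit Defensive.

Import GRing.Theory.

Section Base.
Local Open Scope group_scope.

Variables (aT : finGroupType) (D : {set aT}) (rT : finType).
Variables (to : action D rT) (G : {set aT}) (Omega : {set rT}).

Definition is_base (L : {set rT}) : bool :=
  (L \subset Omega) && ('C_G(L | to) == 1).

(* When G acts faithfully on Omega, Omega itself is a base, so the minimum
   below ranges over a nonempty family of sets. *)
Definition base_size : nat := #|[arg min_(L < Omega | is_base L) #|L|]|.

End Base.

Definition ksubsets (n k : nat) : {set {set 'I_n}} :=
  [set A : {set 'I_n} | #|A| == k].

Definition b (n k : nat) : nat :=
  base_size ('P^* )%act [set: 'S_n] (ksubsets n k).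

Local Open Scope nat_scope.

(* A partition of n has at most n parts, each at most n: it is encoded as the
   weakly decreasing sequence of its parts, padded with zeros to length n. *)
Definition is_partition (n : nat) (p : n.-tuple 'I_n.+1) : bool :=
  sorted geq (map val p) && (sumn (map val p) == n).

(* For i > 0, the number of parts equal to i; mult p 0 only counts padding. *)
Definition mult (n : nat) (p : n.-tuple 'I_n.+1) (i : nat) : nat :=
  count_mem i (map val p).

Definition inner_sum (n k : nat) (p : n.-tuple 'I_n.+1) : nat :=
  \sum_(q : k.-tuple 'I_k.+1 | is_partition q)
    \prod_(1 <= j < k.+1) 'C(mult p j, mult q j).

Local Open Scope ring_scope.

Definition partition_sum (n k l : nat) : rat :=
  \sum_(p : n.-tuple 'I_n.+1 | is_partition p)
    (-1) ^+ (n - \sum_(1 <= i < n.+1) mult p i)%N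
    * (n`!%:R / (\prod_(1 <= i < n.+1) (i ^ mult p i * (mult p i)`!))%N%:R)
    * (inner_sum k p)%:R ^+ l.

(* Main.v *)
Require Import Defs.
From mathcomp Require Import all_boot all_order all_fingroup all_algebra.
From mathcomp Require Import zify.

(** The permutations of cycle type [(1^c_1, ..., n^c_n)] number
    [n! / prod_i i^c_i c_i!], have sign [(-1)^(n - sum_i c_i)], and fix as many
    [k]-subsets as there are ways to choose cycles of total length [k]; grouping
    these choices by the lengths used gives the inner sum.  Hence the partition
    sum is [sum_s sgn(s) fix(s)^l], that is, the sum over all [l]-tuples of
    [k]-subsets of the sum of the signs of their stabilizer.  The stabilizer of a
    tuple of subsets is generated by transpositions, so the sum of its signs is
    1 if it is trivial and 0 otherwise.  The partition sum therefore counts the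
    [l]-tuples of [k]-subsets whose members form a base. *)

Set Implicit Arguments.
Unset Strict Implicit.
Unset Printing Implicit Defensive.

Import GroupScope GRing.Theory Num.Theory.
Local Open Scope nat_scope.

(** * Counting permutations by cycle type *)

Definition cycle_points (T : finType) (A : {set T}) (s : {perm T}) (m : nat) :=
  #|[set z in A | #|porbit s z| == m]|.

Definition incr (c : nat -> nat) (j i : nat) : nat := c i + (i == j).

(** The subtraction truncates: when [c j] is 0 the result is [c] itself, so counting statements
    guard it with [0 < c j]. *)
Definition decr (c : nat -> nat) (j i : nat) : nat := c i - (i == j).

(* The type is recorded by points rather than cycles: m * c m points of A lie on
   m-cycles, so the fixed points of s outside A are not counted. *)
Definition perms_of_type (T : finType) (A : {set T}) (c : nat -> nat) :=
  [set s : {perm T} | perm_on A s &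
     all (fun m => cycle_points A s m == m * c m) (iota 1 #|T|)].

Definition centralizer_order (N : nat) (c : nat -> nat) : nat :=
  \prod_(1 <= i < N.+1) (i ^ c i * (c i)`!).

Lemma decrK (c : nat -> nat) (j : nat) : 0 < c j -> incr (decr c j) j =1 c.
Proof. by move=> cj i; rewrite /incr /decr; case: eqP => [->|_]; lia. Qed.

(** Only the factor at [j] changes, and the product has no factor at 0. Index 0 stands for the empty
    cycle that is left when a fixed point is deleted, hence the factor 1 there. *)
Lemma centralizer_order_incr (N : nat) (c : nat -> nat) (j : nat) : j <= N ->
  centralizer_order N (incr c j) =
  (if j == 0 then 1 else j * (c j).+1) * centralizer_order N c.
Proof.
move=> jN; have eq_off i : i != j -> incr c j i = c i.
  by move=> /negPf ij; rewrite /incr ij addn0.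
rewrite /centralizer_order; case: eqVneq => [j0|j0].
  rewrite mul1n; apply: eq_big_nat => i i1.
  by rewrite eq_off //; lia.
have jr : j \in index_iota 1 N.+1 by rewrite mem_index_iota; lia.
rewrite !(bigD1_seq j jr (iota_uniq _ _)) /= mulnA; congr (_ * _).
  by rewrite /incr eqxx addn1 expnS factS; nia.
by apply: eq_bigr => i /eq_off ->.
Qed.

Lemma sum_mul_incr (N : nat) (c : nat -> nat) (j : nat) : j <= N ->
  \sum_(1 <= i < N.+1) i * incr c j i = \sum_(1 <= i < N.+1) i * c i + j.
Proof.
move=> jN; under eq_bigr do rewrite mulnDr.
rewrite big_split /=; congr (_ + _).
have [->|j0] := eqVneq j 0.
  by apply: big1_seq => i /=; rewrite mem_index_iota; case: eqP; lia.
have jr : j \in index_iota 1 N.+1 by rewrite mem_index_iota; lia.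
rewrite (bigD1_seq j jr (iota_uniq _ _)) /= eqxx muln1 big1 ?addn0 //.
by move=> i /negPf ->; rewrite muln0.
Qed.

(** The product splices the fixed point [x] into the cycle of [y], just before [y]: the preimage of
    [y] now goes to [x], and [x] goes to [y]. For [y = x] nothing changes. *)
Lemma porbit_insert (T : finType) (s : {perm T}) (x y : T) : s x = x ->
  porbit (s * tperm x y)%g y = x |: porbit s y.
Proof.
move=> sx; set t := (s * tperm x y)%g.
have tx : t x = y by rewrite permM sx tpermL.
have xy : x \in porbit t y by rewrite porbit_sym -tx -{1}[t]expg1 mem_porbit.
have clo z : z \in porbit t y -> t z \in porbit t y.
  by move=> /porbitP[i ->]; rewrite -permM -expgSr mem_porbit.
have clos z : z \in porbit s y -> s z \in porbit s y.
  by move=> /porbitP[i ->]; rewrite -permM -expgSr mem_porbit.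
apply/eqP; rewrite eqEsubset; apply/andP; split; apply/subsetP => z.
  move=> /porbitP[i ->{z}]; elim: i => [|i IH].
    by rewrite perm1 !inE porbit_id orbT.
  rewrite expgSr permM; move: IH; set w := (t ^+ i) y.
  rewrite !inE => /orP[/eqP ->|wy]; first by rewrite tx porbit_id orbT.
  rewrite permM; case: tpermP => [_|_|_ _].
  - by rewrite porbit_id orbT.
  - by rewrite eqxx.
  - by rewrite clos ?orbT.
rewrite !inE => /orP[/eqP ->//|/porbitP[i ->{z}]]; elim: i => [|i IH].
  by rewrite perm1 porbit_id.
rewrite expgSr permM; move: IH; set w := (s ^+ i) y => wy.
(* The two permutations agree at [w] unless [s w] is [y] or [x], and both of these already lie in
   the new cycle. *)
have [->|nwy] := eqVneq (s w) y; first exact: porbit_id.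
have [->|nwx] := eqVneq (s w) x; first exact: xy.
have -> : s w = t w by rewrite permM tpermD // eq_sym.
exact: clo.
Qed.

(** The iterates of [z] under [s] meet neither [x] nor [y], so the transposition never acts on
    them. *)
Lemma porbit_insert_notin (T : finType) (s : {perm T}) (x y z : T) :
  s x = x -> z != x -> z \notin porbit s y ->
  porbit (s * tperm x y)%g z = porbit s z.
Proof.
move=> sx zx zy.
have fixx i : (s ^+ i) x = x.
  by elim: i => [|i IH]; rewrite ?perm1 // expgSr permM IH.
suff E i : ((s * tperm x y)%g ^+ i) z = (s ^+ i) z.
  by apply/setP => u; apply/porbitP/porbitP => -[i ->]; exists i; rewrite E.
elim: i => [|i IH]; first by rewrite !perm1.
rewrite expgSr permM IH permM -[s _]permM -expgSr tpermD //.
  apply: contra_neq zx => E; apply: (@perm_inj _ (s ^+ i.+1)).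
  by rewrite fixx.
by apply: contraNneq zy => ->; rewrite porbit_sym mem_porbit.
Qed.

Lemma porbit_perm_on (T : finType) (A : {set T}) (s : {perm T}) (y : T) :
  perm_on A s -> y \in A -> porbit s y \subset A.
Proof.
move=> sA yA; apply/subsetP => _ /porbitP[i ->].
elim: i => [|i IH]; first by rewrite perm1.
by rewrite expgSr permM perm_closed.
Qed.

Lemma porbit_fixed (T : finType) (s : {perm T}) (x : T) :
  s x = x -> porbit s x = [set x].
Proof.
move=> sx; apply/setP => z; rewrite inE; apply/porbitP/eqP => [[i ->]|->].
  by elim: i => [|i IH]; rewrite ?perm1 // expgSr permM IH.
by exists 0; rewrite perm1.
Qed.

(* Uniform in y: for y = x the inserted point is a new fixed point, and the
   cycle of y away from x is empty, so j below is 0. *)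
Lemma cycle_points_insert (T : finType) (A : {set T}) (s : {perm T}) (x y : T)
    (m : nat) (j := #|porbit s y :\ x|) :
    x \notin A -> perm_on A s -> y \in x |: A ->
  cycle_points (x |: A) (s * tperm x y)%g m + (m == j) * j =
  cycle_points A s m + (m == j.+1) * j.+1.
Proof.
move=> xA sA yA; have sx : s x = x by apply: out_perm sA xA.
set t := (s * tperm x y)%g; set O := porbit s y :\ x.
have tO : porbit t y = x |: O.
  by rewrite porbit_insert //; apply/setP => z; rewrite !inE; case: eqP.
have ctO : #|porbit t y| = j.+1 by rewrite tO cardsU1 !inE eqxx.
have OA : O \subset A.
  apply/subsetP => z; rewrite !inE => /andP[zx zy].
  case/setU1P: yA => [yx|yA]; last by rewrite (subsetP (porbit_perm_on sA yA)).
  by move: zy; rewrite yx porbit_fixed // inE (negPf zx).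
have csO z : z \in O -> #|porbit s z| = j.
  rewrite !inE => /andP[zx zy].
  have /eqP -> : porbit s z == porbit s y by rewrite eq_porbit_mem.
  rewrite /j (cardsD1 x (porbit s y)); case: (boolP (x \in _)) => // xy.
  suff : z \in porbit s x by rewrite porbit_fixed // inE (negPf zx).
  by move: xy zy; rewrite -eq_porbit_mem => /eqP ->.
(* Both counts are split along the cycle that changes: [x |: O] after the insertion, [O] before it.
   Outside these the two sets of points coincide. *)
rewrite /cycle_points -(cardsID (x |: O) [set z in x |: A | _]).
rewrite -(cardsID O [set z in A | _]).
have -> : [set z in x |: A | #|porbit t z| == m] :&: (x |: O) =
          if m == j.+1 then x |: O else set0.
  rewrite -tO; apply/setP => z; rewrite in_setI.
  have [zy|] := boolP (z \in porbit t y); last first.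
    by move=> H; rewrite andbF; case: ifP => _; rewrite ?inE ?(negPf H).
  have zA : z \in x |: A by apply: subsetP zy; rewrite tO setUS.
  move: (zy); rewrite -eq_porbit_mem in_set zA => /eqP ->; rewrite ctO eq_sym.
  by case: eqP; rewrite ?zy ?inE.
have -> : [set z in A | #|porbit s z| == m] :&: O = if m == j then O else set0.
  apply/setP => z; rewrite in_setI.
  have [zO|/negPf zO] := boolP (z \in O); last first.
    by rewrite andbF; case: ifP; rewrite ?zO ?inE.
  rewrite in_set (subsetP OA _ zO) csO // eq_sym.
  by case: eqP; rewrite ?zO ?inE.
have -> : [set z in x |: A | #|porbit t z| == m] :\: (x |: O) =
          [set z in A | #|porbit s z| == m] :\: O.
  apply/setP => z; rewrite !inE.
  have [->|zx] /= := eqVneq z x; first by rewrite (negPf xA).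
  have [zy|zy] /= := boolP (z \in porbit s y); first by [].
  by rewrite porbit_insert_notin.
have -> : #|if m == j.+1 then x |: O else set0| = (m == j.+1) * j.+1.
  by case: eqP; rewrite ?cards0 // -tO ctO mul1n.
have -> : #|if m == j then O else set0| = (m == j) * j.
  by case: eqP; rewrite ?cards0 ?mul1n.
lia.
Qed.

(** The insertion replaces a [j]-cycle by a [j.+1]-cycle, so [s] must have one [j.+1]-cycle fewer
    and one [j]-cycle more than [c] prescribes. For [j = 0] the increment falls on index 0, which
    the type does not see. *)
Lemma mem_perms_of_type_insert (T : finType) (A : {set T}) (s : {perm T})
    (x y : T) (c : nat -> nat) (j := #|porbit s y :\ x|) :
    x \notin A -> perm_on A s -> y \in x |: A ->
  ((s * tperm x y)%g \in perms_of_type (x |: A) c) =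
  (0 < c j.+1) && (s \in perms_of_type A (incr (decr c j.+1) j)).
Proof.
move=> xA sA yA.
have sxA : perm_on (x |: A) (s * tperm x y)%g.
  apply: perm_onM; first by apply: subset_trans sA (subsetUr _ _).
  apply: subset_trans (tperm_on x y) _.
  by apply/subsetP => _ /set2P[] -> //; rewrite setU11.
have jT : j < #|T|.
  rewrite -cardsT (cardsD1 x [set: T]) inE ltnS subset_leq_card //.
  by rewrite setSD ?subsetT.
have cpi m := cycle_points_insert m xA sA yA.
rewrite -/j in cpi; clearbody j.
rewrite !inE sxA sA /=; apply/allP/andP => [H|[cj /allP H] m mT].
  (* The new permutation has at least [j.+1] points on cycles of length [j.+1]. *)
  have cj : 0 < c j.+1.
    have /eqP := H j.+1 ltac:(by rewrite mem_iota add1n !ltnS).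
    have := cpi j.+1; rewrite eqxx gtn_eqF // addn0 => ->.
    by case: (c j.+1) => //; lia.
  split=> //; apply/allP => m mT; have := H m mT; have := cpi m.
  rewrite /incr /decr; do 2 case: eqP => ?; subst; nia.
have := H m mT; have := cpi m.
rewrite /incr /decr; do 2 case: eqP => ?; subst; nia.
Qed.

(** A permutation [s] of [x |: B] factors uniquely as a permutation of [B] followed by a
    transposition [tperm x y], with [y = s x]. *)
Lemma sum_perm_on_setU1 (T : finType) (B : {set T}) (x : T)
    (F : {perm T} -> nat) : x \notin B ->
  \sum_(s | perm_on (x |: B) s) F s =
  \sum_(s | perm_on B s) \sum_(y in x |: B) F (s * tperm x y)%g.
Proof.
move=> xB; pose g (s : {perm T}) := ((s * tperm x (s x))%g, s x).
rewrite pair_big /= (reindex_onto (fun p => p.1 * tperm x p.2)%g g) /=; last first.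
  by move=> s _; rewrite /g /= -mulgA tperm2 mulg1.
apply: eq_bigl => -[s y] /=.
have tx : y \in x |: B -> perm_on (x |: B) (tperm x y).
  move=> yB; apply: subset_trans (tperm_on x y) _.
  by apply/subsetP => _ /set2P[] -> //; rewrite setU11.
apply/andP/andP => [[sB /eqP[E1 E2]]|[sB yB]].
  have yB : y \in x |: B by rewrite -E2 perm_closed ?setU11.
  split=> //; rewrite E2 in E1.
  have sx : s x = x.
    by apply: (@perm_inj _ (tperm x y)); rewrite -permM E2 tpermL.
  apply/subsetP => z; rewrite inE => sz.
  have : z \in x |: B.
    by rewrite -E1 in sz; apply: (subsetP (perm_onM sB (tx yB))); rewrite inE.
  by case/setU1P => [zx|//]; rewrite zx sx eqxx in sz.
split; first by rewrite perm_onM ?tx //; apply: subset_trans sB (subsetUr _ _).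
have sx : s x = x by apply: out_perm sB xB.
by rewrite /g permM sx tpermL -mulgA tperm2 mulg1.
Qed.

(** This counts the ways to extend a [j]-cycle by [x]. Only [y = x] gives [j = 0], since every point
    of [B] has a nonempty cycle inside [B]. *)
Lemma card_insert_points (T : finType) (B : {set T}) (s : {perm T}) (x : T)
    (j : nat) : x \notin B -> perm_on B s ->
  #|[set y in x |: B | #|porbit s y :\ x| == j]| =
  if j == 0 then 1 else cycle_points B s j.
Proof.
move=> xB sB; have sx : s x = x by apply: out_perm sB xB.
have pB y : y \in B -> porbit s y :\ x = porbit s y.
  move=> yB; apply/setDidPl; rewrite disjoint_sym disjoints1.
  by apply: contraNN xB; apply: subsetP; apply: porbit_perm_on.
case: eqVneq => [->|j0].
  rewrite -(cards1 x); congr #|pred_of_set _|; apply/setP => y; rewrite !inE.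
  have [->|yx] /= := eqVneq y x; first by rewrite porbit_fixed // setDv cards0.
  have [yB|//] := boolP (y \in B); rewrite pB //=.
  exact/negbTE/card_porbit_neq0.
congr #|pred_of_set _|; apply/setP => y; rewrite !inE.
have [->|yx] /= := eqVneq y x.
  by rewrite porbit_fixed // setDv cards0 eq_sym (negPf j0) (negPf xB).
by have [yB|//] := boolP (y \in B); rewrite pB.
Qed.

(* Deleting a point x from its cycle maps the permutations of A to those of
   B = A \ x; a permutation of B whose type is c with one (j+1)-cycle shortened
   to a j-cycle has w j preimages of type c. *)
Lemma card_perms_of_type (T : finType) (A : {set T}) (c : nat -> nat) :
    \sum_(1 <= i < #|T|.+1) i * c i = #|A| ->
  #|perms_of_type A c| * centralizer_order #|T| c = #|A|`!.
Proof.
move cA : #|A| => a; elim: a A c cA => [|a IH] A c cA sumc.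
  have c0 i : i \in iota 1 #|T| -> c i = 0.
    move=> iT; move/eqP: sumc; rewrite sum_nat_seq_eq0 => /allP /(_ i).
    rewrite /index_iota subn1 /= => /(_ iT).
    by move: iT; rewrite muln_eq0 mem_iota; case: i => //= i _ /eqP.
  have -> : perms_of_type A c = [set 1%g].
    apply/setP => s; rewrite !inE; apply/andP/eqP => [[sA _]|->].
      by apply: perm_on_id sA _; rewrite cA.
    split; first exact: perm_on1.
    apply/allP => m mT; rewrite c0 // muln0 -leqn0 -cA subset_leq_card //.
    by apply/subsetP => z; rewrite inE => /andP[].
  rewrite cards1 mul1n /centralizer_order big1_seq // => i /=.
  by rewrite /index_iota subn1 => /c0 ->.
have /card_gt0P[x xA] : 0 < #|A| by rewrite cA.
pose B := A :\ x; have defA : A = x |: B by rewrite setD1K.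
have xB : x \notin B by rewrite !inE eqxx.
have cB : #|B| = a by move: cA; rewrite (cardsD1 x) xA => -[].
pose N := #|T|; pose d j := decr c j.+1.
pose w j := if j == 0 then 1 else j * (d j j).+1.
have -> : #|perms_of_type A c| =
    \sum_(j < N) (0 < c j.+1) * (#|perms_of_type B (incr (d j) j)| * w j).
  have -> : #|perms_of_type A c| =
      \sum_(s | perm_on A s) (s \in perms_of_type A c).
    rewrite -sum1_card big_mkcond [RHS]big_mkcond /=; apply: eq_bigr => s _.
    by rewrite inE; case: (perm_on A s); case: all.
  rewrite defA sum_perm_on_setU1 //.
  transitivity (\sum_(s | perm_on B s) \sum_(j < N)
      (0 < c j.+1) * ((s \in perms_of_type B (incr (d j) j)) * w j)).
    apply: eq_bigr => s sB.
    have jN y : #|porbit s y :\ x| < N.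
      rewrite /N -cardsT (cardsD1 x [set: T]) inE ltnS subset_leq_card //.
      by rewrite setSD ?subsetT.
    (* The insertion points are grouped by the length [j] of the cycle that they extend. *)
    rewrite (partition_big (fun y => Ordinal (jN y)) predT) //=.
    apply: eq_bigr => j _.
    have sumE : \sum_(y in x |: B | Ordinal (jN y) == j)
        ((s * tperm x y)%g \in perms_of_type (x |: B) c) =
      \sum_(y in [set y in x |: B | #|porbit s y :\ x| == j])
        (0 < c j.+1) * (s \in perms_of_type B (incr (d j) j)).
      apply: eq_big => [y|y]; first by rewrite !inE.
      move=> /andP[yB /eqP <-].
      by rewrite mem_perms_of_type_insert // mulnb.
    rewrite sumE sum_nat_const card_insert_points //.
    have [st|_] := boolP (s \in _); last by rewrite !muln0.
    rewrite mulnC -mulnA mul1n; congr (_ * _); rewrite /w mul1n.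
    (* A permutation of type [incr (d j) j] has [(d j j).+1] cycles of length [j], hence [w j]
       points on them. *)
    case: eqVneq => // j0; move: st; rewrite inE sB => /allP /(_ j).
    rewrite mem_iota lt0n j0 add1n ltnS ltnW ?ltn_ord // => /(_ isT) /eqP ->.
    by rewrite /incr eqxx addn1.
  rewrite exchange_big /=; apply: eq_bigr => j _.
  rewrite -big_distrr -big_distrl /=; congr (_ * (_ * _)).
  rewrite -sum1_card big_mkcond [RHS]big_mkcond /=; apply: eq_bigr => s _.
  by rewrite inE; case: (perm_on B s); case: all.
(* The factor [a.+1] is expanded as the total weight of [c], so that the two sides can be compared
   for each [j] separately. *)
have -> : a.+1`! = a`! * \sum_(j < N) j.+1 * c j.+1.
  by rewrite factS mulnC -{1}sumc big_add1 /= big_mkord.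
rewrite big_distrl big_distrr /=; apply: eq_bigr => j _.
have [cj|] := ltnP 0 (c j.+1); last by case: (c j.+1); rewrite // !muln0.
rewrite mul1n.
have zc : centralizer_order N c = (j.+1 * c j.+1) * centralizer_order N (d j).
  have -> : centralizer_order N c = centralizer_order N (incr (d j) j.+1).
    by apply: eq_bigr => i _; rewrite decrK.
  rewrite centralizer_order_incr ?ltn_ord //=; congr (_ * _ * _).
  by rewrite /d /decr eqxx; lia.
have zc' := @centralizer_order_incr N (d j) j (ltnW (ltn_ord j)).
have := IH B (incr (d j) j) cB.
rewrite sum_mul_incr 1?ltnW ?ltn_ord // -/N zc' -/(w j) zc => <-.
  by rewrite -!mulnA; congr (_ * (_ * _)); rewrite mulnA mulnC.
(* It remains to check the weight required by the induction hypothesis: shortening one cycle by a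
   point lowers the weight of [c] from [a.+1] to [a]. *)
have := @sum_mul_incr N (d j) j.+1 (ltn_ord j).
have -> : \sum_(1 <= i < N.+1) i * incr (d j) j.+1 i =
          \sum_(1 <= i < N.+1) i * c i by apply: eq_bigr => i _; rewrite decrK.
by rewrite sumc; lia.
Qed.

(** * Partitions and multisets of parts *)

Lemma sumn_count_mem (k : nat) (t : seq nat) : all (leq^~ k) t ->
  sumn t = \sum_(1 <= j < k.+1) j * count_mem j t.
Proof.
elim: t => [_|x t IH /= /andP[xk /IH ->]].
  by rewrite big1 // => j _; rewrite muln0.
under [RHS]eq_bigr do rewrite mulnDr.
rewrite big_split /=; congr (_ + _).
have [->|x0] := eqVneq x 0.
  rewrite big1_seq // => j /=; rewrite mem_index_iota.
  by case: j => // j; rewrite muln0.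
rewrite (bigD1_seq x) ?iota_uniq ?mem_index_iota ?lt0n ?x0 ?ltnS //=.
rewrite eqxx muln1 big1 ?addn0 // => j.
by rewrite eq_sym => /negPf ->; rewrite muln0.
Qed.

Lemma size_count_mem (k : nat) (t : seq nat) : all (leq^~ k) t ->
  size t = count_mem 0 t + \sum_(1 <= j < k.+1) count_mem j t.
Proof.
elim: t => [_|x t IH /= /andP[xk /IH ->]]; first by rewrite big1.
rewrite big_split /= addnACA -add1n; congr (_ + _).
have [->|x0] := eqVneq x 0.
  by rewrite big1_seq // => j /=; rewrite mem_index_iota; case: j.
rewrite (bigD1_seq x) ?iota_uniq ?mem_index_iota ?lt0n ?x0 ?ltnS //=.
rewrite eqxx big1 // => j.
by rewrite eq_sym => /negPf ->.
Qed.

Lemma geq_trans : transitive geq.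
Proof. by move=> y x z /= xy yz; apply: leq_trans yz xy. Qed.

Lemma geq_total : total geq.
Proof. by move=> x y; rewrite /= leq_total. Qed.

Lemma geq_anti : antisymmetric geq.
Proof. by move=> x y /andP[/= xy yx]; apply/eqP; rewrite eqn_leq xy yx. Qed.

Lemma all_leq_parts (k : nat) (q : k.-tuple 'I_k.+1) : all (leq^~ k) (map val q).
Proof. by rewrite all_map; apply/allP => i _ /=; rewrite -ltnS ltn_ord. Qed.

(** A sorted sequence is determined by its multiplicities. That of the padding 0 is not assumed
    equal, but follows because both sequences have length [k]. *)
Lemma partition_mult_inj (k : nat) (q1 q2 : k.-tuple 'I_k.+1) :
    is_partition q1 -> is_partition q2 ->
  {in iota 1 k, mult q1 =1 mult q2} -> q1 = q2.
Proof.
move=> /andP[s1 _] /andP[s2 _] H; apply: val_inj; apply: (inj_map val_inj).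
apply: sorted_eq geq_trans geq_anti _ _ s1 s2 _.
apply/allP => a _ /=; apply/eqP.
have [a0|] := eqVneq a 0; last first.
  move=> a0; have [ak|ak] := leqP a k; first by apply: H; rewrite mem_iota; lia.
  have notin (q : k.-tuple 'I_k.+1) : count_mem a (map val q) = 0.
    apply/count_memPn; apply: contraTN ak => /(allP (all_leq_parts q)).
    by rewrite -leqNgt.
  by rewrite !notin.
have := size_count_mem (all_leq_parts q1).
have := size_count_mem (all_leq_parts q2).
rewrite !size_map !size_tuple a0.
have -> : \sum_(1 <= j < k.+1) count_mem j [seq val i | i <- q1] =
          \sum_(1 <= j < k.+1) count_mem j [seq val i | i <- q2].
  by apply: eq_big_seq => j; rewrite /index_iota subn1; apply: H.
by move=> E2 E1; apply: addIn (etrans (esym E1) E2).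
Qed.

(** The bound excludes entries that the multiplicities over 1, ..., [k] would miss. The number of
    zeros is left free, since [q] is padded and [t] is not. *)
Definition has_parts (k : nat) (t : seq nat) (q : k.-tuple 'I_k.+1) : bool :=
  all (leq^~ k) t && all (fun j => count_mem j t == mult q j) (iota 1 k).

Lemma leq_sumn (x : nat) (t : seq nat) : x \in t -> x <= sumn t.
Proof.
elim: t => //= y t IH; rewrite inE => /orP[/eqP ->|/IH]; first exact: leq_addr.
by move/leq_trans; apply; apply: leq_addl.
Qed.

Lemma size_leq_sumn (t : seq nat) : all (leq 1) t -> size t <= sumn t.
Proof. by elim: t => //= x t IH /andP[x0 /IH]; lia. Qed.

(** Positive parts of sum [k] number at most [k], so [t] can be padded with zeros to length [k] and
    then sorted. *)
Lemma partition_of_parts (k : nat) (t : seq nat) :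
    all (leq 1) t -> sumn t = k ->
  exists2 q : k.-tuple 'I_k.+1, is_partition q & has_parts t q.
Proof.
move=> t1 tk.
have leqk : all (leq^~ k) t by apply/allP => x /leq_sumn; rewrite tk.
pose u := sort geq (t ++ nseq (k - size t) 0).
have pu : perm_eq u (t ++ nseq (k - size t) 0) by rewrite perm_sort.
have su : size u == k.
  by rewrite (perm_size pu) size_cat size_nseq -tk subnKC ?size_leq_sumn.
have uk : all (leq^~ k) u.
  rewrite (perm_all _ pu) all_cat leqk /=.
  by apply/allP => x; rewrite mem_nseq => /andP[_ /eqP ->].
have vu : map val (map (@inord k) u) = u.
  rewrite -map_comp -[RHS]map_id; apply/eq_in_map => x /(allP uk) xk /=.
  by rewrite inordK.
have su' : size (map (@inord k) u) == k by rewrite size_map.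
exists (Tuple su').
  rewrite /is_partition /= vu sort_sorted; last exact: geq_total.
  by rewrite (perm_sumn pu) sumn_cat tk sumn_nseq mul0n addn0 eqxx.
rewrite /has_parts leqk /=; apply/allP => j; rewrite mem_iota => /andP[j1 _].
rewrite /mult /= vu (seq.permP pu) count_cat count_nseq /=.
by case: j j1 => //= j _; rewrite addn0.
Qed.

(** Exactly one partition has the entries of [t] as its parts, and it is a partition of their sum.
    This collapses sums over partitions to indicators. *)
Lemma sum_has_parts (k : nat) (t : seq nat) : all (leq 1) t ->
  \sum_(q : k.-tuple 'I_k.+1 | is_partition q) has_parts t q = (sumn t == k).
Proof.
move=> t1; have [tk|tk] := eqVneq (sumn t) k; last first.
  apply: big1 => q /andP[_ /eqP qk]; apply/eqP; rewrite eqb0.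
  apply: contraNN tk => /andP[leqk /allP H].
  rewrite -[X in _ == X]qk (sumn_count_mem leqk) (sumn_count_mem (all_leq_parts q)).
  by apply/eqP/eq_big_seq => j; rewrite /index_iota subn1 => /H /eqP ->.
have [q qp qt] := partition_of_parts t1 tk.
rewrite (bigD1 q) //= qt big1 // => r /andP[rp rq].
apply/eqP; rewrite eqb0; apply: contraNN rq => /andP[_ /allP rt].
case/andP: qt => _ /allP qt.
apply/eqP; apply: partition_mult_inj => // j jk.
by rewrite -(eqP (rt j jk)) -(eqP (qt j jk)).
Qed.

Lemma count_mem_image (I : finType) (B : {set I}) (f : I -> nat) (j : nat) :
  count_mem j (map f (enum B)) = #|[set i in B | f i == j]|.
Proof.
rewrite count_map -size_filter cardE /enum_mem -filter_predI.
by congr size; apply: eq_filter => i; rewrite /= !inE andbC.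
Qed.

(** The choices inside the fibers of [f] over 1, ..., [k] are independent. The induction on [k]
    splits off the fiber over the largest value. *)
Lemma card_subsets_by_fiber (I : finType) (P : {set I}) (f : I -> nat)
    (k : nat) (m : nat -> nat) :
  #|[set B : {set I} | [&& B \subset P, [forall i in B, 0 < f i <= k] &
       all (fun j => #|[set i in B | f i == j]| == m j) (iota 1 k)]]| =
  \prod_(1 <= j < k.+1) 'C(#|[set i in P | f i == j]|, m j).
Proof.
elim: k => [|k IH].
  rewrite big_geq // -[RHS](cards1 (set0 : {set I})).
  congr #|pred_of_set _|; apply/setP => B; rewrite !inE andbT.
  apply/andP/eqP => [[_ /forall_inP H]|->].
    apply/setP => i; rewrite inE; by apply/negP => /H; rewrite leqn0 lt0n andNb.
  by rewrite sub0set; split=> //; apply/forall_inP => i; rewrite inE.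
rewrite big_nat_recr // [RHS]/= -{}IH -cards_draws -cardsX.
set X := setX _ _; set Y := [set B | _].
pose lo (B : {set I}) := [set i in B | f i <= k].
pose hi (B : {set I}) := [set i in B | f i == k.+1].
have iotaS : iota 1 k.+1 = rcons (iota 1 k) k.+1.
  by rewrite -cats1 -[in RHS](add1n k) -(iotaD 1 k 1) addn1.
have loC B j : j \in iota 1 k ->
    [set i in lo B | f i == j] = [set i in B | f i == j].
  rewrite mem_iota => jk; apply/setP => i; rewrite !inE -andbA.
  by case: eqP => [->|_]; rewrite ?andbF // ?andbT; case: (i \in B) => //=; lia.
have YX B : B \in Y -> (lo B, hi B) \in X.
  rewrite !inE iotaS all_rcons => /and3P[BP /forall_inP Bf /andP[Bk /allP Bj]].
  apply/andP; split; apply/andP; split.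
  - by apply/subsetP => i; rewrite inE => /andP[/(subsetP BP)].
  - apply/andP; split.
      by apply/forall_inP => i; rewrite inE => /andP[/Bf /andP[-> _]].
    by apply/allP => j jk; rewrite loC ?Bj.
  - by apply/subsetP => i; rewrite !inE => /andP[/(subsetP BP) ->].
  - exact: Bk.
have YK B : B \in Y -> lo B :|: hi B = B.
  rewrite inE => /and3P[_ /forall_inP Bf _].
  apply/setP => i; rewrite !inE -andb_orr; case: (boolP (i \in B)) => //= /Bf; lia.
have XK p : p \in X -> (lo (p.1 :|: p.2), hi (p.1 :|: p.2)) = p.
  case: p => B1 B2; rewrite !inE /=.
  move=> /andP[/and3P[_ /forall_inP B1f _] /andP[/subsetP B2f _]].
  congr (_, _); apply/setP => i; rewrite !inE.
    have := B1f i; have := B2f i; rewrite !inE.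
    case: (i \in B1); case: (i \in B2) => //= Ha Hb.
    - by have := Hb isT; lia.
    - by have := Hb isT; lia.
    - by have /andP[_ /eqP ->] := Ha isT; rewrite ltnn.
  have := B1f i; have := B2f i; rewrite !inE.
  case: (i \in B1); case: (i \in B2) => //= Ha Hb.
  - by have /andP[_] := Ha isT.
  - by have := Hb isT; lia.
  - by have /andP[_] := Ha isT.
have XY p : p \in X -> p.1 :|: p.2 \in Y.
  move=> pX; have [E1 E2] : lo (p.1 :|: p.2) = p.1 /\ hi (p.1 :|: p.2) = p.2.
    by have := XK p pX; case: p {pX} => B1 B2 /= [].
  rewrite inE iotaS all_rcons.
  case: p pX E1 E2 => B1 B2 /=; rewrite !inE /=.
  move=> /andP[/and3P[B1P /forall_inP B1f /allP B1j] /andP[/subsetP B2f B2c]] E1 E2.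
  apply/and3P; split.
  - by rewrite subUset B1P /=; apply/subsetP => i /B2f; rewrite inE => /andP[].
  - apply/forall_inP => i; rewrite inE => /orP[/B1f|/B2f]; first lia.
    by rewrite inE => /andP[_ /eqP ->] /=.
  - rewrite -/(hi _) E2 B2c /=; apply/allP => j jk.
    by rewrite -loC // E1 B1j.
(* Splitting into [(lo B, hi B)] and taking the union are mutually inverse, so each is injective and
   yields one inequality. *)
apply/eqP; rewrite eqn_leq; apply/andP; split.
  rewrite -(@card_in_imset _ _ (fun B => (lo B, hi B)) Y).
    by apply: subset_leq_card; apply/subsetP => _ /imsetP[B BY ->]; apply: YX.
  by move=> B1 B2 /YK E1 /YK E2 [F1 F2]; rewrite -E1 -E2 F1 F2.
rewrite -(@card_in_imset _ _ (fun p => p.1 :|: p.2) X).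
  by apply: subset_leq_card; apply/subsetP => _ /imsetP[p pX ->]; apply: XY.
by move=> p1 p2 /XK E1 /XK E2 /= E; rewrite -E1 -E2 E.
Qed.

(** * Fixed subsets and signs *)

Lemma setact_permP (T : finType) (A : {set T}) (s : {perm T}) :
  reflect (forall x, (s x \in A) = (x \in A)) (('P^*)%act A s == A).
Proof.
apply: (iffP eqP) => [E x|E].
  by rewrite -{1}E /= /setact /= (mem_imset _ _ (@perm_inj _ s)).
apply/eqP; rewrite eqEcard card_setact leqnn andbT.
by apply/subsetP => _ /imsetP[x xA ->]; rewrite /= /aperm E.
Qed.

Lemma porbit_step (T : finType) (s : {perm T}) (x : T) :
  porbit s (s x) = porbit s x.
Proof. exact: (porbit_perm s 1 x). Qed.

Lemma mem_cover_porbits (T : finType) (s : {perm T}) (B : {set {set T}})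
    (x : T) : B \subset porbits s -> (x \in cover B) = (porbit s x \in B).
Proof.
move=> /subsetP Bs; apply/bigcupP/idP => [[C CB xC]|xB]; last first.
  by exists (porbit s x); rewrite ?porbit_id.
have /imsetP[z _ Cz] := Bs _ CB; move: xC.
by rewrite Cz -eq_porbit_mem => /eqP ->; rewrite -Cz.
Qed.

Lemma porbits_trivIset (T : finType) (s : {perm T}) : trivIset (porbits s).
Proof.
apply/trivIsetP => _ _ /imsetP[x _ ->] /imsetP[y _ ->]; apply: contraNT.
move=> /pred0Pn[z /andP[/= zx zy]].
by move: zx zy; rewrite -!eq_porbit_mem => /eqP <- /eqP <-.
Qed.

Lemma card_cover_porbits (T : finType) (s : {perm T}) (B : {set {set T}}) :
  B \subset porbits s -> #|cover B| = \sum_(C in B) #|C|.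
Proof.
by move=> Bs; apply/esym/eqP; apply: (trivIsetS Bs (porbits_trivIset s)).
Qed.

Lemma card_porbits_gt0 (T : finType) (s : {perm T}) (C : {set T}) :
  C \in porbits s -> 0 < #|C|.
Proof. by move=> /imsetP[x _ ->]; rewrite lt0n card_porbit_neq0. Qed.

(** A subset is fixed exactly when it is a union of cycles, and the cycles used are determined by
    their union; thus [cover] is the bijection. *)
Lemma card_fixed_subsets (T : finType) (s : {perm T}) (k : nat) :
  #|[set A : {set T} | (#|A| == k) && (('P^*)%act A s == A)]| =
  #|[set B : {set {set T}} | (B \subset porbits s) &&
                             (\sum_(C in B) #|C| == k)]|.
Proof.
set X := [set A | _]; set Y := [set B | _].
rewrite -(@card_in_imset _ _ (@cover T) Y); last first.
  move=> B1 B2; rewrite !inE => /andP[B1s _] /andP[B2s _] E.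
  apply/setP => C; have [/imsetP[x _ ->]|nC] := boolP (C \in porbits s).
    by rewrite -!mem_cover_porbits // E.
  by rewrite !(contraNF (subsetP _ C) nC).
congr #|pred_of_set _|; apply/setP => A; rewrite inE; apply/andP/imsetP.
  move=> [cA /setact_permP fA].
  pose B := [set C in porbits s | C \subset A].
  have Bs : B \subset porbits s by apply/subsetP => C; rewrite inE => /andP[].
  have AE : A = cover B.
    apply/setP => x; rewrite (mem_cover_porbits _ Bs) inE imset_f //=.
    apply/idP/subsetP => [xA _ /porbitP[i ->]|]; last by apply; apply: porbit_id.
    by elim: i => [|i IH]; rewrite ?perm1 // expgSr permM fA.
  by exists B => //; rewrite inE Bs -(card_cover_porbits Bs) -AE.
move=> [B]; rewrite inE => /andP[Bs cB] ->.
rewrite (card_cover_porbits Bs); split=> //; apply/setact_permP => x.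
by rewrite !(mem_cover_porbits _ Bs) porbit_step.
Qed.

Definition cycle_lengths (T : finType) (s : {perm T}) : seq nat :=
  map (fun C : {set T} => #|C|) (enum (porbits s)).

Lemma sumn_map_enum (I : finType) (B : {set I}) (f : I -> nat) :
  sumn (map f (enum B)) = \sum_(i in B) f i.
Proof. by rewrite sumnE big_map big_enum. Qed.

Lemma map_card_gt0 (T : finType) (s : {perm T}) (B : {set {set T}}) :
  B \subset porbits s ->
  all (leq 1) (map (fun C : {set T} => #|C|) (enum B)).
Proof.
move=> /subsetP Bs; rewrite all_map; apply/allP => C; rewrite mem_enum => /Bs.
exact: card_porbits_gt0.
Qed.

Lemma sumn_cycle_lengths (T : finType) (s : {perm T}) :
  sumn (cycle_lengths s) = #|T|.
Proof.
rewrite sumn_map_enum -(card_cover_porbits (subxx _)) -cardsT.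
congr #|pred_of_set _|; apply/setP => x.
by rewrite (mem_cover_porbits _ (subxx (porbits s))) inE imset_f.
Qed.

Lemma cycle_points_setT (T : finType) (s : {perm T}) (j : nat) :
  cycle_points [set: T] s j = j * count_mem j (cycle_lengths s).
Proof.
rewrite count_mem_image /cycle_points.
set B := [set C in porbits s | _].
have Bs : B \subset porbits s by apply/subsetP => C; rewrite inE => /andP[].
have -> : [set z in [set: T] | #|porbit s z| == j] = cover B.
  by apply/setP => x; rewrite (mem_cover_porbits _ Bs) !inE imset_f.
rewrite (card_cover_porbits Bs) (eq_bigr (fun=> j)).
  by rewrite sum_nat_const mulnC.
by move=> C; rewrite inE => /andP[_ /eqP].
Qed.

Lemma has_parts_cycle_lengths (n : nat) (s : 'S_n) (p : n.-tuple 'I_n.+1) :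
  has_parts (cycle_lengths s) p = (s \in perms_of_type [set: 'I_n] (mult p)).
Proof.
rewrite inE /has_parts.
have -> : all (leq^~ n) (cycle_lengths s).
  by apply/allP => x /leq_sumn; rewrite sumn_cycle_lengths card_ord.
have -> : perm_on [set: 'I_n] s by apply/subsetP => x; rewrite inE.
rewrite card_ord /=; apply: eq_in_all => j; rewrite mem_iota => /andP[j1 _].
by rewrite cycle_points_setT eqn_mul2l eqn0Ngt j1.
Qed.

(** For each partition of [k], the product of binomials counts the sets of cycles of [s] having
    those lengths. Together these are all sets of cycles of total length [k], whose unions are the
    fixed [k]-subsets. *)
Lemma inner_sumE (n k : nat) (s : 'S_n) (p : n.-tuple 'I_n.+1) :
    k <= n -> has_parts (cycle_lengths s) p ->
  inner_sum k p =
  #|[set A : {set 'I_n} | (#|A| == k) && (('P^*)%act A s == A)]|.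
Proof.
move=> kn /andP[_ /allP sp].
rewrite card_fixed_subsets.
pose card_of (C : {set 'I_n}) := #|C|.
transitivity (\sum_(q : k.-tuple 'I_k.+1 | is_partition q)
   \sum_(B : {set {set 'I_n}} | B \subset porbits s)
      has_parts (map card_of (enum B)) q).
  apply: eq_bigr => q _.
  transitivity (\prod_(1 <= j < k.+1)
      'C(#|[set C in porbits s | card_of C == j]|, mult q j)).
    (* Since [k <= n], every such [j] is in the range where [p] records the cycles of [s]. *)
    apply: eq_big_seq => j; rewrite mem_index_iota => jk.
    by rewrite -count_mem_image (eqP (sp j _)) // mem_iota; lia.
  rewrite -card_subsets_by_fiber -sum1_card big_mkcond [RHS]big_mkcond /=.
  apply: eq_bigr => B _; rewrite inE; case: (boolP (B \subset _)) => //= Bs.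
  rewrite /has_parts.
  have -> : [forall C in B, 0 < card_of C <= k] =
            all (leq^~ k) [seq card_of i | i <- enum B].
    apply/forall_inP/allP => [H m /mapP[C]|H C CB].
      by rewrite mem_enum => CB ->; have /andP[] := H C CB.
    rewrite (card_porbits_gt0 (subsetP Bs _ CB)) /=.
    by apply: H; apply: map_f; rewrite mem_enum.
  rewrite [X in _ && X](eq_all (a2 := fun j =>
    count_mem j [seq card_of i | i <- enum B] == mult q j)).
    have ifE c : (if c then 1 else 0) = nat_of_bool c by case: c.
    exact: ifE.
  by move=> j; rewrite count_mem_image.
rewrite exchange_big -sum1_card big_mkcond [RHS]big_mkcond /=.
apply: eq_bigr => B _; rewrite inE; case: (boolP (B \subset _)) => //= Bs.
rewrite sum_has_parts ?sumn_map_enum ?(map_card_gt0 Bs) //.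
Qed.

Lemma sum_mult_cycle_lengths (n : nat) (s : 'S_n) (p : n.-tuple 'I_n.+1) :
  has_parts (cycle_lengths s) p ->
  \sum_(1 <= i < n.+1) mult p i = #|porbits s|.
Proof.
move=> /andP[/size_count_mem E /allP sp].
have -> : #|porbits s| = size (cycle_lengths s) by rewrite size_map -cardE.
rewrite E (count_memPn _) ?add0n; last first.
  by apply/negP => /(allP (map_card_gt0 (subxx (porbits s)))).
by apply: eq_big_seq => j; rewrite /index_iota subn1 => /sp /eqP <-.
Qed.

Section SignedSum.
Local Open Scope ring_scope.

(** By definition [odd_perm] compares the parities of the numbers of points and of cycles; the bound
    on the number of cycles keeps the subtraction from truncating. *)
Lemma sign_porbits (R : pzRingType) (n : nat) (s : 'S_n) :
  (-1) ^+ (n - #|porbits s|)%N = (-1) ^+ s :> R.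
Proof.
have le_n : (#|porbits s| <= n)%N.
  by apply: leq_trans (leq_imset_card _ _) _; rewrite card_ord.
rewrite -signr_odd oddB //.
by rewrite /odd_perm card_ord.
Qed.

Lemma partition_sum_perm (n k l : nat) : (k <= n)%N ->
  partition_sum n k l = \sum_(s : 'S_n) (-1) ^+ s *
    #|[set A : {set 'I_n} | (#|A| == k) && (('P^*)%act A s == A)]|%:R ^+ l.
Proof.
move=> kn; rewrite /partition_sum.
pose G (s : 'S_n) : rat := (-1) ^+ s *
  #|[set A : {set 'I_n} | (#|A| == k) && (('P^*)%act A s == A)]|%:R ^+ l.
transitivity (\sum_(p : n.-tuple 'I_n.+1 | is_partition p)
    \sum_(s : 'S_n) (has_parts (cycle_lengths s) p)%:R * G s).
  apply: eq_bigr => p pp.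
  have sumE : (\sum_(1 <= i < #|'I_n|.+1) i * mult p i)%N = #|[set: 'I_n]|.
    rewrite cardsT !card_ord -(sumn_count_mem (all_leq_parts p)).
    by case/andP: pp => _ /eqP.
  have := card_perms_of_type sumE; rewrite cardsT !card_ord => cE.
  have zE : (\prod_(1 <= i < n.+1) (i ^ mult p i * (mult p i)`!))%N =
            centralizer_order n (mult p) by [].
  have z0 : (centralizer_order n (mult p))%:R != 0 :> rat.
    rewrite pnatr_eq0 -lt0n; have := fact_gt0 n; rewrite -cE muln_gt0.
    by case/andP.
  (* The quotient becomes the number of permutations of type [p], and the term is then spread over
     these permutations. *)
  rewrite zE -cE natrM mulfK //.
  pose S := perms_of_type [set: 'I_n] (mult p).
  rewrite -/S -mulrA mulrCA -sum1_card natr_sum mulr_suml [RHS](bigID (mem S)) /=.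
  rewrite [X in _ = _ + X]big1 ?addr0; last first.
    by move=> s sS; rewrite has_parts_cycle_lengths (negPf sS) mul0r.
  apply: eq_bigr => s sS.
  have hp : has_parts (cycle_lengths s) p by rewrite has_parts_cycle_lengths.
  by rewrite hp !mul1r (sum_mult_cycle_lengths hp) sign_porbits (inner_sumE kn hp).
(* Each permutation has exactly one cycle type, so it contributes once. *)
rewrite exchange_big /=; apply: eq_bigr => s _.
rewrite -mulr_suml -natr_sum sum_has_parts ?(map_card_gt0 (subxx (porbits s))) //.
by rewrite sumn_cycle_lengths card_ord eqxx mul1r.
Qed.

Definition tuple_stab (n l : nat) (f : {ffun 'I_l -> {set 'I_n}}) :
    {set 'S_n} := [set s | [forall i, ('P^*)%act (f i) s == f i]].

Lemma tuple_stabP (n l : nat) (f : {ffun 'I_l -> {set 'I_n}}) (s : 'S_n) :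
  reflect (forall i x, (s x \in f i) = (x \in f i)) (s \in tuple_stab f).
Proof.
rewrite inE; apply: (iffP forallP) => [H i x|H i]; last by apply/setact_permP.
by have /setact_permP := H i.
Qed.

(* A nontrivial stabilizer of subsets contains the transposition of any moved
   point with its image, which pairs off even and odd elements. *)
Lemma sum_sign_tuple_stab (n l : nat) (f : {ffun 'I_l -> {set 'I_n}}) :
  \sum_(s in tuple_stab f) (-1) ^+ s = (tuple_stab f == [set 1%g])%:R :> rat.
Proof.
case: eqP => [->|ne]; first by rewrite big_set1 odd_perm1.
have [s sf s1] : exists2 s, s \in tuple_stab f & s != 1%g.
  apply/exists_inP; apply: contraPT ne => /exists_inPn H; apply.
  apply/eqP; rewrite eqEsubset sub1set; apply/andP; split.
    by apply/subsetP => s /H; rewrite inE negbK.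
  by apply/tuple_stabP => i x; rewrite perm1.
have [x sx] : exists x, s x != x.
  apply/existsP; apply: contraNT s1 => /existsPn H; apply/eqP/permP => x.
  by rewrite perm1; have /negPn/eqP := H x.
pose t := tperm x (s x).
(* The points [x] and [s x] lie in the same members of the tuple, so [t] also stabilizes it. *)
have tf i y : (t y \in f i) = (y \in f i).
  by rewrite /t; case: tpermP => [->|->|//]; rewrite (tuple_stabP _ _ sf).
have : \sum_(s in tuple_stab f) (-1) ^+ s =
       - \sum_(s in tuple_stab f) (-1) ^+ s :> rat.
  rewrite [LHS](reindex_inj (mulgI t)) /= -sumrN; apply: eq_big => u.
    apply/tuple_stabP/tuple_stabP => H i y; last by rewrite permM H tf.
    have -> : u y = (t * u)%g (t y) by rewrite permM tpermK.
    by rewrite H tf.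
  by rewrite odd_mul_tperm eq_sym sx /= signrN.
by move/eqP; rewrite eq_sym eqNr => /eqP.
Qed.

(** The power [l] of the number of fixed [k]-subsets counts ordered tuples of them, repetitions
    allowed. Exchanging the sums leaves the signed sum over the stabilizer of each tuple. *)
Lemma partition_sum_card (n k l : nat) : (k <= n)%N ->
  partition_sum n k l =
  #|[set f : {ffun 'I_l -> {set 'I_n}} |
      [forall i, f i \in ksubsets n k] && (tuple_stab f == [set 1%g])]|%:R.
Proof.
move=> kn; rewrite partition_sum_perm //.
transitivity (\sum_(s : 'S_n)
    \sum_(f : {ffun 'I_l -> {set 'I_n}} | [forall i, f i \in ksubsets n k])
      (s \in tuple_stab f)%:R * (-1) ^+ s : rat).
  apply: eq_bigr => s _; rewrite -mulr_suml mulrC; congr (_ * _).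
  rewrite -natrX -natr_sum; congr _%:R.
  set X := [set A : {set 'I_n} | _].
  have <- : #|@ffun_on 'I_l X| = (#|X| ^ l)%N.
    by rewrite card_ffun_on card_ord.
  rewrite -sum1_card big_mkcond [RHS]big_mkcond /=; apply: eq_bigr => f _.
  have -> : (f \in ffun_on X) =
    [forall i, f i \in ksubsets n k] && (s \in tuple_stab f).
    apply/ffun_onP/andP => [H|[/forallP H1]].
      split; first by apply/forallP => i; have := H i; rewrite !inE => /andP[].
      by rewrite inE; apply/forallP => i; have := H i; rewrite inE => /andP[].
    rewrite inE => /forallP H2 i; rewrite inE.
    by have := H1 i; rewrite inE => ->; apply: H2.
  by case: [forall i, _]; case: (s \in _).
rewrite exchange_big /= -sum1_card natr_sum big_mkcond [RHS]big_mkcond /=.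
apply: eq_bigr => f _; rewrite inE; case: [forall i, _] => //=.
have -> : (if tuple_stab f == [set 1%g] then 1 else 0) =
          (tuple_stab f == [set 1%g])%:R :> rat by case: ifP.
rewrite -sum_sign_tuple_stab [RHS]big_mkcond /=; apply: eq_bigr => s _.
by case: ifP; rewrite ?mul1r ?mul0r.
Qed.

End SignedSum.

(** * Bases of the action on [k]-subsets and the base size *)

(** If [s] moves [x], some [k]-subset contains [x] but not [s x], and [s] cannot fix it. This
    provides the initial candidate for the minimum defining [base_size]. *)
Lemma is_base_ksubsets (n k : nat) : 0 < k < n ->
  is_base ('P^*)%act [set: 'S_n] (ksubsets n k) (ksubsets n k).
Proof.
move=> /andP[k0 kn]; rewrite /is_base subxx /= eqEsubset sub1set group1 andbT.
apply/subsetP => s; rewrite in_setI => /andP[_ /astabP sK]; rewrite inE.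
apply/eqP/permP => x; rewrite perm1; apply/eqP.
apply: contraTT isT => sx.
(* The other [k.-1] points are chosen among the [n - 2] points different from [x] and [s x], which
   is possible because [k < n]. *)
have [A] : exists A : {set 'I_n}, A \in [set A : {set 'I_n} |
    (A \subset ~: [set x; s x]) && (#|A| == k.-1)].
  apply/card_gt0P; rewrite cards_draws cardsCs setCK card_ord cards2 bin_gt0.
  by rewrite eq_sym sx; lia.
rewrite inE => /andP[/subsetP Ax cA].
have xA : x \notin A by apply/negP => /Ax; rewrite !inE eqxx.
have sxA : s x \notin A by apply/negP => /Ax; rewrite !inE eqxx orbT.
have /sK /eqP /setact_permP /(_ x) : x |: A \in ksubsets n k.
  by rewrite inE cardsU1 xA (eqP cA); lia.
by rewrite !inE eqxx (negPf sx) (negPf sxA).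
Qed.

Lemma base_of_tuple (n k l : nat) (f : {ffun 'I_l -> {set 'I_n}}) :
    (forall i, f i \in ksubsets n k) -> tuple_stab f = [set 1%g] ->
  is_base ('P^*)%act [set: 'S_n] (ksubsets n k) (f @: [set: 'I_l]).
Proof.
move=> fk f1; rewrite /is_base; apply/andP; split.
  by apply/subsetP => _ /imsetP[i _ ->].
rewrite setTI -[1%g]/[set 1%g] -f1; apply/eqP/setP => s.
apply/astabP/idP => [H|].
  by rewrite inE; apply/forallP => i; rewrite H // imset_f.
by rewrite inE => /forallP H _ /imsetP[i _ ->]; apply/eqP/H.
Qed.

Theorem theorem1p1 (n k : nat) (n_gt0 : 0 < n) (k_gt0 : 0 < k)
    (le_2k_n : 2 * k <= n) :
  [/\ 0 < b n k,
      partition_sum n k (b n k) <> 0%R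
    & forall l : nat, 0 < l -> partition_sum n k l <> 0%R -> b n k <= l].
Proof.
have kn : 0 < k < n by lia.
have kn' : k <= n by lia.
rewrite /b /base_size; case: arg_minnP => [|L /andP[LK /eqP L1] Lmin].
  exact: is_base_ksubsets.
split.
(* An empty base would have the whole symmetric group as stabilizer, and this contains a
   transposition because [n] is at least 2. *)
- rewrite lt0n cards_eq0; apply/eqP => L0.
  have n1 : 1 < n by lia.
  pose x := Ordinal n_gt0; pose y := Ordinal n1.
  have : tperm x y \in 'C_[set: 'S_n](L | 'P^*).
    by rewrite setTI; apply/astabP => A; rewrite L0 inE.
  rewrite L1 inE => /eqP /permP /(_ x); rewrite perm1 tpermL.
  by move/(congr1 val).
- rewrite partition_sum_card //; apply/eqP; rewrite pnatr_eq0 -lt0n.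
  (* Enumerating the minimal base [L] gives a tuple of length [#|L|] that is counted. *)
  apply/card_gt0P; exists [ffun i => enum_val i]; rewrite inE; apply/andP; split.
    by apply/forallP => i; rewrite ffunE (subsetP LK) // enum_valP.
  rewrite -[[set 1%g]]/(1%g : {set 'S_n}) -L1 setTI; apply/eqP/setP => s.
  rewrite inE; apply/forallP/astabP => [H A AL|H i].
    have := H (enum_rank_in AL A); rewrite ffunE enum_rankK_in //.
    by move/eqP.
  by rewrite ffunE H // enum_valP.
- move=> l _; rewrite partition_sum_card // => /eqP; rewrite pnatr_eq0 -lt0n.
  move=> /card_gt0P[f]; rewrite inE => /andP[/forallP fk /eqP f1].
  (* The members of a counted tuple form a base; repetitions can only make it smaller than [l]. *)
  apply: leq_trans (Lmin _ (base_of_tuple fk f1)) _.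
  by rewrite (leq_trans (leq_imset_card _ _)) // cardsT card_ord.
Qed.
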